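(* For every $\varepsilon>0$ there exists $n_0$ such that for all $n\ge n_0$, every subset $A\subseteq\{1,\dots,n\}$ with no nontrivial solution $(x_1,\dots,x_5)\in A^5$ to the equation $x_1+x_2+2x_3=x_4+3x_5$ satisfies $|A|\le\varepsilon\sqrt n$. Here a solution is trivial if it is of the form $(x_1,\dots,x_5)=(x,y,y,x,y)$ or $(y,x,y,x,y)$ for some $x,y\in\mathbb Z$.
   Context: Equivalently, such a set has size $o(\sqrt n)$. *)

(* Defs.v *)
From Stdlib Require Import Reals ZArith List.
Open Scope Z_scope.

Definition trivial_sol (x1 x2 x3 x4 x5 : Z) : Prop :=
  exists x y : Z,
    (x1 = x /\ x2 = y /\ x3 = y /\ x4 = x /\ x5 = y) \/
    (x1 = y /\ x2 = x /\ x3 = y /\ x4 = x /\ x5 = y).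

Definition no_nontrivial_sol (A : list Z) : Prop :=
  forall x1 x2 x3 x4 x5 : Z,
    In x1 A -> In x2 A -> In x3 A -> In x4 A -> In x5 A ->
    x1 + x2 + 2 * x3 = x4 + 3 * x5 ->
    trivial_sol x1 x2 x3 x4 x5.

(* Main.v *)
Require Import Defs.
From Stdlib Require Import Reals ZArith List Lra Lia.

(** Embed [A] in [Z/M] with [M = 6n+1], so that 2 and 3 are invertible and no new solutions appear.
    Taking [x3 = x5] shows that [A] is a Sidon set, hence its Fourier transform has fourth moment
    at most [2M|A|^2]; if moreover [M <= L|A|^2], only boundedly many frequencies [r] satisfy
    [|A^(r)| >= |A|/k], and [Z/M] splits into boundedly many cells on which all their characters
    are constant up to [2/k].

    Let [B] be a translate to the origin of a largest cell. Replacing [1_A] by the function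
    [G = 1_A * 1_B] changes the normalised number of solutions by only [O(|A|^3/k)], and the Sidon
    property bounds [sum G^2] by [2|B|^2]: [G] is a dense model of [A].

    For [G] solutions are plentiful, by a Bogolyubov-type argument: the weight [rep y] of the
    representations [y = x1 + x2 - x4] is large at most points [y], weighted by [G], and nearly
    invariant under shifts in the spectral cells (for a much smaller [k]). If [y], [x3], [x5] lie in
    a common cell, then [3 x5 - 2 x3] is such a shift of [y]; one heavy cell thus yields a
    positive proportion of all conceivable solutions. So [A] has at least [c|A|^3] solutions, against
    at most [2|A|^2] trivial ones, and [|A|] is bounded in terms of [L]. *)

(* The module confines the MathComp notations, which would change the reading of [<=] on [nat] in
   the final theorem. *)
Module SolutionFree.

From HB Require Import structures.
From mathcomp Require Import all_boot all_order all_algebra all_field.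
From mathcomp Require Import ring zify.
Set Implicit Arguments. Unset Strict Implicit. Unset Printing Implicit Defensive.
Import Order.TTheory GRing.Theory Num.Theory.
Local Open Scope ring_scope.

(** * Fourier analysis on a finite commutative ring *)

Section Fourier.
Context (R : finComNzRingType) (e : R -> algC).
Hypothesis eD : forall x y, e (x + y) = e x * e y.
Hypothesis normr_e : forall x, `|e x| = 1.
(** Orthogonality: the maps [x |-> e (r * x)] are all the characters of the additive group, so [R]
    serves as its own dual and frequencies can be multiplied by 2 and 3 within [R]. *)
Hypothesis sum_e : forall x, \sum_r e (r * x) = #|R|%:R * (x == 0)%:R.

Implicit Types (h : R -> algC) (r u x y z w : R).

Lemma e_neq0 x : e x != 0.
Proof. by rewrite -normr_eq0 normr_e oner_neq0. Qed.

Lemma e0 : e 0 = 1.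
Proof. by apply: (mulfI (e_neq0 0)); rewrite -eD addr0 mulr1. Qed.

Lemma eN x : e (- x) = (e x)^*.
Proof.
apply: (mulfI (e_neq0 x)).
by rewrite -eD subrr e0 -normCK normr_e expr1n.
Qed.

Lemma e_dist x y : `|e x - e y| = `|e (x - y) - 1|.
Proof.
have -> : e x - e y = (e (x - y) - 1) * e y by rewrite mulrBl -eD subrK mul1r.
by rewrite normrM normr_e mulr1.
Qed.

Lemma dist_eD x y : `|e (x + y) - 1| <= `|e x - 1| + `|e y - 1|.
Proof.
have -> : e (x + y) - 1 = (e x - 1) + e x * (e y - 1) by rewrite eD; ring.
by apply: le_trans (ler_normD _ _) _; rewrite normrM normr_e mul1r.
Qed.

Lemma dist_eN x : `|e (- x) - 1| = `|e x - 1|.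
Proof. by rewrite eN -[RHS]norm_conjC rmorphB rmorph1. Qed.

Lemma dist_eMn x n : `|e (x *+ n) - 1| <= n%:R * `|e x - 1|.
Proof.
elim: n => [|n IHn]; first by rewrite mulr0n e0 subrr normr0 mul0r.
rewrite mulrS -[n.+1]add1n natrD mulrDl mul1r.
exact: le_trans (dist_eD _ _) (lerD (lexx _) IHn).
Qed.

Definition hat h r := \sum_x h x * e (r * x).

Lemma hat_inv h u : \sum_r hat h r * e (- (r * u)) = #|R|%:R * h u.
Proof.
under eq_bigr do rewrite /hat mulr_suml.
rewrite exchange_big /=.
transitivity (\sum_x h x * (#|R|%:R * (x - u == 0)%:R)).
  apply: eq_bigr => x _; rewrite -sum_e mulr_sumr.
  by apply: eq_bigr => r _; rewrite mulrBr eD mulrA.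
rewrite (bigD1 u) //= subrr eqxx big1 ?addr0 ?mulr1 1?mulrC // => x xu.
by rewrite subr_eq0 (negbTE xu) !mulr0.
Qed.

Lemma parseval h : \sum_r hat h r * hat h (- r) = #|R|%:R * \sum_x h x ^+ 2.
Proof.
rewrite mulr_sumr; under [RHS]eq_bigr => x _.
  rewrite expr2 mulrA -hat_inv mulr_suml; over.
rewrite exchange_big /=; apply: eq_bigr => r _.
rewrite [X in _ * X]/hat mulr_sumr; apply: eq_bigr => x _.
by rewrite mulNr; ring.
Qed.

(* In [x1 + x2 + 2 x3 = x4 + 3 x5], the variables [x], [y], [z], [w] of [rep] and [sols] stand for
   [x1], [x2], [x3], [x5]; the equation determines [x4], the argument of the last [h]. *)
Definition rep h u := \sum_x \sum_y h x * h y * h (x + y - u).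

(** Inversion applied to the factor [h (x + y - u)] separates the variables [x] and [y]. *)
Lemma rep_hat h u :
  #|R|%:R * rep h u = \sum_r hat h r * hat h (- r) ^+ 2 * e (r * u).
Proof.
rewrite /rep mulr_sumr; under eq_bigr => x _.
  rewrite mulr_sumr; under eq_bigr => y _.
    rewrite mulrCA -hat_inv mulr_sumr; over.
  rewrite exchange_big; over.
rewrite exchange_big /=; apply: eq_bigr => r _.
set H := hat h r; rewrite expr2 mulrA [X in _ = _ * X * _ * _]/hat.
rewrite mulr_sumr !mulr_suml; apply: eq_bigr => x _.
rewrite /hat mulr_sumr mulr_suml; apply: eq_bigr => y _.
have -> : - (r * (x + y - u)) = - r * x + (- r * y + r * u) by ring.
rewrite !eD; ring.
Qed.

(** The sum on the left is the additive energy of [h]: it weighs the quadruples with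
    [x + y = u + v]. *)
Lemma energy_hat h :
  #|R|%:R * (\sum_u h u * rep h u) = \sum_r hat h r ^+ 2 * hat h (- r) ^+ 2.
Proof.
rewrite mulr_sumr; under eq_bigr do rewrite mulrCA rep_hat mulr_sumr.
rewrite exchange_big /=; apply: eq_bigr => r _.
set H := hat h (- r); rewrite [X in _ = X * _]expr2 -mulrA.
rewrite [X in _ = X * _]/hat mulr_suml.
by apply: eq_bigr => u _; ring.
Qed.

Definition sols h := \sum_z \sum_w h z * h w * rep h (w *+ 3 - z *+ 2).

Lemma sols_hat h : #|R|%:R * sols h =
  \sum_r hat h r * hat h (- r) ^+ 2 * (hat h (r *+ 3) * hat h (- (r *+ 2))).
Proof.
rewrite /sols mulr_sumr; under eq_bigr => z _.
  rewrite mulr_sumr; under eq_bigr => w _.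
    rewrite mulrCA rep_hat mulr_sumr; over.
  rewrite exchange_big; over.
rewrite exchange_big /=; apply: eq_bigr => r _.
set H := _ * _ ^+ 2; rewrite mulrA [X in _ = _ * X]/hat mulr_sumr.
apply: eq_bigr => z _; rewrite [X in _ = _ * X * _]/hat mulr_sumr mulr_suml.
apply: eq_bigr => w _.
have -> : r * (w *+ 3 - z *+ 2) = r *+ 3 * w + - (r *+ 2) * z by ring.
rewrite eD; ring.
Qed.

Section NonNeg.
Context (h : R -> algC).
Hypothesis h_ge0 : forall x, 0 <= h x.

Lemma hatN r : hat h (- r) = (hat h r)^*.
Proof.
rewrite rmorph_sum; apply: eq_bigr => x _.
by rewrite rmorphM /= -eN mulNr (CrealP _) // ger0_real.
Qed.

Lemma norm_hatN r : `|hat h (- r)| = `|hat h r|.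
Proof. by rewrite hatN norm_conjC. Qed.

Lemma norm_hat_le r : `|hat h r| <= \sum_x h x.
Proof.
apply: le_trans (ler_norm_sum _ _ _) _; apply: ler_sum => x _.
by rewrite normrM normr_e mulr1 ger0_norm.
Qed.

Lemma hat0 : hat h 0 = \sum_x h x.
Proof. by apply: eq_bigr => x _; rewrite mul0r e0 mulr1. Qed.

Lemma sum_norm_hat2 : \sum_r `|hat h r| ^+ 2 = #|R|%:R * \sum_x h x ^+ 2.
Proof. by rewrite -parseval; apply: eq_bigr => r _; rewrite normCK hatN. Qed.

Lemma sum_norm_hat4 :
  \sum_r `|hat h r| ^+ 4 = #|R|%:R * \sum_u h u * rep h u.
Proof.
rewrite energy_hat; apply: eq_bigr => r _.
by rewrite -[4%N]/(2 * 2)%N exprM normCK hatN exprMn.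
Qed.

(** The left side is the contribution of the zero frequency to the fourth moment. *)
Lemma energy_lb : (\sum_x h x) ^+ 4 <= #|R|%:R * \sum_u h u * rep h u.
Proof.
rewrite -sum_norm_hat4 [leRHS](bigD1 0) //= hat0 ger0_norm ?sumr_ge0 // lerDl.
by apply: sumr_ge0 => r _; rewrite exprn_ge0.
Qed.

Lemma rep_ge0 u : 0 <= rep h u.
Proof. by do 2!apply: sumr_ge0 => ? _; rewrite !mulr_ge0. Qed.

Lemma sols_ge0 : 0 <= sols h.
Proof. by do 2!apply: sumr_ge0 => ? _; rewrite !mulr_ge0 ?rep_ge0. Qed.

End NonNeg.

End Fourier.

(** * Pigeonhole principle and a subdivision of the unit circle *)

Lemma pigeonhole (I F : finType) (w : I -> algC) (col : I -> F) :
  (forall i, 0 <= w i) -> (0 < #|I|)%N ->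
  exists c, \sum_i w i <= #|F|%:R * \sum_(i | col i == c) w i.
Proof.
move=> w_ge0 /card_gt0P[i0 _].
pose W c := \sum_(i | col i == c) w i.
have W_ge0 c : 0 <= W c by apply: sumr_ge0.
have sumW : \sum_i w i = \sum_c W c by rewrite (partition_big col xpredT).
case: (boolP [exists c, \sum_i w i <= #|F|%:R * W c]) => [/existsP //|].
rewrite negb_exists => /forallP small; exfalso.
have lt_c c : #|F|%:R * W c < \sum_i w i.
  by rewrite real_ltNge ?small // ger0_real ?mulr_ge0 ?ler0n ?sumr_ge0.
have: \sum_c #|F|%:R * W c < \sum_(c : F) \sum_i w i.
  apply: ltr_sum => [|c _]; last exact: lt_c.
  (* Strictness of the summed inequality requires [F] to be inhabited. *)
  by apply/hasP; exists (col i0); rewrite ?mem_index_enum.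
by rewrite -mulr_sumr -sumW sumr_const -[X in _ < X]mulr_natl ltxx.
Qed.

Lemma truncn_dist (a b : algC) :
  0 <= a -> 0 <= b -> Num.truncn a = Num.truncn b -> `|a - b| <= 1.
Proof.
move=> a0 b0 eq_ab.
have /andP[la ua] := truncn_itv a0; have /andP[lb ub] := truncn_itv b0.
rewrite real_ler_norml ?rpredB ?ger0_real //; apply/andP; split.
  rewrite lerBrDr addrC lerBlDr; apply: le_trans (ltW ub) _.
  by rewrite -eq_ab -natr1 lerD2r.
rewrite lerBlDr; apply: le_trans (ltW ua) _.
by rewrite eq_ab -natr1 addrC lerD2l.
Qed.

Section Cells.
Variable k : nat.
Hypothesis k_gt0 : (0 < k)%N.

(** Cuts [[-1, 1]] into intervals of length [1/k]. The endpoint 1 has index [2k], hence [2k + 1]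
    values; [inord] resorts to its default only for indices above [2k], which [grid_dist]
    excludes. *)
Definition grid (t : algC) : 'I_k.*2.+1 := inord (Num.truncn ((1 + t) * k%:R)).

Lemma grid_dist (s t : algC) : s \is Num.real -> t \is Num.real ->
  `|s| <= 1 -> `|t| <= 1 -> grid s = grid t -> `|s - t| <= k%:R^-1.
Proof.
move=> sR tR s1 t1 /(congr1 val).
have k0 : 0 < k%:R :> algC by rewrite ltr0n.
have bound (u : algC) : u \is Num.real -> `|u| <= 1 ->
    0 <= (1 + u) * k%:R /\ (Num.truncn ((1 + u) * k%:R) < k.*2.+1)%N.
  move=> uR; rewrite real_ler_norml // => /andP[lu ru].
  have u0 : 0 <= (1 + u) * k%:R.
    by rewrite mulr_ge0 ?ler0n // -lerBlDl sub0r.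
  split=> //; rewrite truncn_lt_nat // -natr1 -addnn natrD.
  apply: (@le_lt_trans _ _ (k%:R + k%:R)); last by rewrite ltrDl ltr01.
  by rewrite mulrDl mul1r lerD2l ler_piMl // ltW.
have [s0 sk] := bound s sR s1; have [t0 tk] := bound t tR t1.
rewrite /= !inordK // => /(truncn_dist s0 t0).
rewrite -mulrBl opprD addrACA subrr add0r normrM [`|k%:R|]ger0_norm ?ler0n //.
by rewrite -ler_pdivlMr // mul1r.
Qed.

Definition cell (z : algC) := (grid ('Re z), grid ('Im z)).

Lemma cell_dist (z t : algC) :
  `|z| = 1 -> `|t| = 1 -> cell z = cell t -> `|z - t| <= 2 / k%:R.
Proof.
move=> z1 t1 [/grid_dist re /grid_dist im].
have le1 (u : algC) : `|u| = 1 -> `|'Re u| <= 1 /\ `|'Im u| <= 1.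
  move=> u1; have := normC2_Re_Im u; rewrite u1 expr1n => /esym eq1.
  have sqR (v : algC) : v \is Num.real -> `|v| ^+ 2 = v ^+ 2.
    by move=> vR; rewrite real_normK.
  split; rewrite -(@expr_le1 _ 2) // sqR ?Creal_Re ?Creal_Im //.
    by rewrite -eq1 lerDl real_exprn_even_ge0 ?Creal_Im.
  by rewrite -eq1 lerDr real_exprn_even_ge0 ?Creal_Re.
have [[zr zi] [tr ti]] := (le1 _ z1, le1 _ t1).
rewrite [z - t]Crect; apply: le_trans (ler_normD _ _) _.
rewrite normrM normCi mul1r !raddfB /= mulr_natl mulr2n.
by apply: lerD; [apply: re | apply: im]; rewrite ?Creal_Re ?Creal_Im.
Qed.

End Cells.

(** * Two elementary inequalities *)

Lemma amgm4 (p q s : algC) : 0 <= p -> 0 <= q -> 0 <= s ->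
  p ^+ 2 * (q * s) *+ 4 <= p ^+ 4 *+ 2 + q ^+ 4 + s ^+ 4.
Proof.
move=> p0 q0 s0.
have sq (a b : algC) : 0 <= a -> 0 <= b -> 0 <= (a - b) ^+ 2.
  by move=> a0 b0; rewrite real_exprn_even_ge0 // rpredB ?ger0_real.
rewrite -subr_ge0.
have -> : p ^+ 4 *+ 2 + q ^+ 4 + s ^+ 4 - p ^+ 2 * (q * s) *+ 4 =
  (p ^+ 2 - q ^+ 2) ^+ 2 + (p ^+ 2 - s ^+ 2) ^+ 2
  + 2 * p ^+ 2 * (q - s) ^+ 2 by ring.
apply: addr_ge0; first by apply: addr_ge0; apply: sq; rewrite exprn_ge0.
by apply: mulr_ge0; [rewrite mulr_ge0 ?exprn_ge0 ?ler0n | apply: sq].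
Qed.

(** Telescoping: the factors are replaced by [m] one at a time. *)
Lemma prod_dist (I : eqType) (s : seq I) (m : algC) (x t : I -> algC) :
  0 <= m -> (forall i, `|x i| <= m) ->
  {in s, forall i, `|x i - m| <= m * t i} ->
  `|\prod_(i <- s) x i - m ^+ size s| <= m ^+ size s * \sum_(i <- s) t i.
Proof.
move=> m0 x_le; elim: s => [|a s IHs] x_dist.
  by rewrite !big_nil subrr normr0 mulr0.
have {}IHs := IHs (fun i si => x_dist i (mem_behead (s := a :: s) si)).
rewrite !big_cons exprS mulrDr.
have -> : forall P : algC, x a * P - m * m ^+ size s =
    (x a - m) * m ^+ size s + x a * (P - m ^+ size s) by move=> P; ring.
apply: le_trans (ler_normD _ _) _; rewrite !normrM; apply: lerD.
  rewrite [`|m ^+ _|]ger0_norm ?exprn_ge0 // mulrAC.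
  by rewrite ler_wpM2r ?exprn_ge0 // x_dist ?mem_head.
by rewrite -mulrA ler_pM.
Qed.

(** * Comparing and bounding weighted numbers of solutions *)

Section Counting.
Context (R : finComNzRingType) (e : R -> algC).
Hypothesis eD : forall x y, e (x + y) = e x * e y.
Hypothesis normr_e : forall x, `|e x| = 1.
Hypothesis sum_e : forall x, \sum_r e (r * x) = #|R|%:R * (x == 0)%:R.
Hypothesis inj2 : injective (fun x : R => x *+ 2).
Hypothesis inj3 : injective (fun x : R => x *+ 3).

Local Notation hat := (hat e).
Implicit Types (h : R -> algC) (r u x y z w : R) (S B : {set R}).

(** The colour of [x] records the cells of all phases [e (r * x)] with [r] in [S]. *)
Lemma phase_partition k S : (0 < k)%N -> exists (F : finType) (col : R -> F),
  #|F| = ((k.*2.+1 ^ 2) ^ #|S|)%N /\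
  forall x y, col x = col y -> {in S, forall r, `|e (r * (x - y)) - 1| <= 2 / k%:R}.
Proof.
move=> k0; exists {ffun {r | r \in S} -> 'I_k.*2.+1 * 'I_k.*2.+1}.
exists (fun x => [ffun r => cell k (e (sval r * x))]); split.
  by rewrite card_ffun card_sig card_prod card_ord mulnn.
move=> x y eq_col r rS; rewrite mulrBr -(e_dist eD) //.
apply: cell_dist => //.
by move/ffunP/(_ (exist _ r rS)): eq_col; rewrite !ffunE.
Qed.

(** Multiplication by 2 or 3 permutes [R], so all factors have the same fourth moment; [amgm4],
    summed over [r], does the work of Hölder's inequality. *)
Lemma holder_hat h : \sum_r `|hat h r| ^+ 2 * (`|hat h (r *+ 3)| * `|hat h (r *+ 2)|)
  <= \sum_r `|hat h r| ^+ 4.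
Proof.
rewrite -(ler_pMn2r (isT : (0 < 4)%N)) -sumrMnl.
have -> : (\sum_r `|hat h r| ^+ 4) *+ 4 = \sum_r (`|hat h r| ^+ 4 *+ 2
    + `|hat h (r *+ 3)| ^+ 4 + `|hat h (r *+ 2)| ^+ 4).
  rewrite !big_split /=.
  have dil n : injective (fun x : R => x *+ n) ->
    \sum_r `|hat h (r *+ n)| ^+ 4 = \sum_r `|hat h r| ^+ 4.
    by move=> inj; rewrite [RHS](reindex_inj inj).
  by rewrite !dil //; ring.
by apply: ler_sum => r _; apply: amgm4.
Qed.

(** The convolution of [h] with the indicator function of [B]; [hatset B] below is the transform of
    that indicator. *)
Definition spread B h x := \sum_(b in B) h (x - b).

Lemma spread_ge0 B h : (forall x, 0 <= h x) -> forall x, 0 <= spread B h x.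
Proof. by move=> h0 x; apply: sumr_ge0. Qed.

Lemma sum_spread B h : \sum_x spread B h x = #|B|%:R * \sum_x h x.
Proof.
rewrite exchange_big /= mulr_natl -sumr_const; apply: eq_bigr => b _.
by rewrite [RHS](reindex_inj (addIr (- b))).
Qed.

Definition hatset B r := \sum_(b in B) e (r * b).

Lemma hat_spread B h r : hat (spread B h) r = hat h r * hatset B r.
Proof.
rewrite /hat; under eq_bigr do rewrite mulr_suml.
rewrite exchange_big /= /hatset mulr_sumr; apply: eq_bigr => b _.
rewrite mulr_suml [RHS](reindex_inj (addIr (- b))); apply: eq_bigr => x _.
by rewrite -mulrA -eD -mulrDr subrK.
Qed.

Lemma hatset_le B r : `|hatset B r| <= #|B|%:R.
Proof.
apply: le_trans (ler_norm_sum _ _ _) _.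
by under eq_bigr do rewrite normr_e; rewrite sumr_const.
Qed.

Lemma hatset_dist B r (t : algC) : {in B, forall b, `|e (r * b) - 1| <= t} ->
  `|hatset B r - #|B|%:R| <= #|B|%:R * t.
Proof.
move=> Bt; rewrite -[X in _ - X]sumr_const -sumrB.
apply: le_trans (ler_norm_sum _ _ _) _.
by rewrite mulr_natl -sumr_const; apply: ler_sum => b /Bt.
Qed.

(** On the Fourier side, spreading multiplies the term of frequency [r] by a product [P r] of five
    values of [hatset B]. For [r] in [S] this product is close to [#|B| ^ 5]; elsewhere the
    smallness of [hat h r] compensates for the trivial bound. [holder_hat] sums what remains. *)
Lemma sols_spread S B h (a d : algC) : (forall x, 0 <= h x) -> 0 <= d ->
  (forall r, `|hat h r| <= a) ->
  (forall r, r \notin S -> `|hat h r| * 2 <= a * (d *+ 8)) ->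
  (forall b r, b \in B -> r \in S -> `|e (r * b) - 1| <= d) ->
  sols (spread B h)
    <= #|B|%:R ^+ 5 * (sols h + a * (d *+ 8) * \sum_u h u * rep h u).
Proof.
move=> h0 d0 hat_le offS onS; set m := #|B|%:R.
have m0 : 0 <= m by rewrite ler0n.
have a0 : 0 <= a := le_trans (normr_ge0 _) (hat_le 0).
have M0 : 0 < #|R|%:R :> algC by rewrite ltr0n; apply/card_gt0P; exists 0.
pose H r := hat h r * hat h (- r) ^+ 2 * (hat h (r *+ 3) * hat h (- (r *+ 2))).
(* Each frequency is paired with the factor by which it magnifies the phase error [d]; these factors
   add up to 8. *)
pose s r := [:: (r, 1%N); (- r, 1%N); (- r, 1%N); (r *+ 3, 3%N); (- (r *+ 2), 2%N)].
pose P r := \prod_(c <- s r) hatset B c.1.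
have P_le r : `|P r| <= m ^+ 5.
  rewrite /P !big_cons big_nil mulr1 !normrM !exprS expr0 mulr1.
  by rewrite !ler_pM ?mulr_ge0 ?normr_ge0 ?hatset_le.
have P_dist r : r \in S -> `|P r - m ^+ 5| <= m ^+ 5 * (d *+ 8).
  move=> rS; have := @prod_dist _ (s r) m (fun c => hatset B c.1)
    (fun c => c.2%:R * d) m0 (fun c => hatset_le _ _).
  have -> : \sum_(c <- s r) c.2%:R * d = d *+ 8.
    by rewrite !big_cons big_nil /=; ring.
  apply=> c cs; apply: hatset_dist => b bB.
  have dn n : `|e (r *+ n * b) - 1| <= n%:R * d.
    rewrite [X in e X]mulrnAl; apply: le_trans (dist_eMn eD normr_e _ _) _.
    by rewrite ler_wpM2l ?ler0n // onS.
  have d1 : `|e (r * b) - 1| <= 1%:R * d by apply: (dn 1%N).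
  by move: cs; rewrite !inE => /or4P[|||/orP[]] /eqP -> /=;
     rewrite ?mulNr ?(dist_eN eD).
have solsG : #|R|%:R * sols (spread B h) = \sum_r H r * P r.
  rewrite (sols_hat eD sum_e); apply: eq_bigr => r _.
  rewrite !hat_spread /P !big_cons big_nil /H /=; ring.
have diff : #|R|%:R * (sols (spread B h) - m ^+ 5 * sols h)
    = \sum_r H r * (P r - m ^+ 5).
  rewrite mulrBr solsG mulrCA (sols_hat eD sum_e) mulr_sumr -sumrB.
  by apply: eq_bigr => r _; rewrite /H; ring.
have H_norm r : `|H r| = `|hat h r| *
    (`|hat h r| ^+ 2 * (`|hat h (r *+ 3)| * `|hat h (r *+ 2)|)).
  by rewrite /H !normrM !(norm_hatN eD normr_e h0); ring.
rewrite mulrDr -lerBlDl -(ler_pM2l M0) diff.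
apply: le_trans (real_ler_norm _) _.
  rewrite -diff realM ?rpredB ?ger0_real ?ler0n ?mulr_ge0 ?exprn_ge0 //.
    exact: sols_ge0 (spread_ge0 B h0).
  exact: sols_ge0.
apply: le_trans (ler_norm_sum _ _ _) _.
apply: (@le_trans _ _ (\sum_r m ^+ 5 * (a * (d *+ 8)) *
   (`|hat h r| ^+ 2 * (`|hat h (r *+ 3)| * `|hat h (r *+ 2)|)))).
  apply: ler_sum => r _; rewrite normrM H_norm mulrAC.
  rewrite ler_wpM2r ?mulr_ge0 ?exprn_ge0 ?normr_ge0 //.
  have [rS|rS] := boolP (r \in S).
    by rewrite mulrCA ler_pM ?normr_ge0 ?P_dist.
  have Pm : `|P r - m ^+ 5| <= m ^+ 5 *+ 2.
    apply: le_trans (ler_normB _ _) _; rewrite mulr2n lerD ?P_le //.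
    by rewrite ger0_norm ?exprn_ge0.
  apply: le_trans (ler_wpM2l (normr_ge0 _) Pm) _.
  have -> : `|hat h r| * (m ^+ 5 *+ 2) = m ^+ 5 * (`|hat h r| * 2) by ring.
  by rewrite ler_wpM2l ?exprn_ge0 ?offS.
rewrite -mulr_sumr; apply: le_trans (ler_wpM2l _ (holder_hat h)) _.
  by rewrite !mulr_ge0 ?exprn_ge0 ?mulrn_wge0.
by rewrite (sum_norm_hat4 eD normr_e sum_e h0) [leLHS]mulrCA -!mulrA.
Qed.

(** In [rep_hat], one factor [hat h] times the phase difference is at most [a * d]: on [S] the
    phases agree, off [S] the transform is small. Parseval sums the other two factors. *)
Lemma rep_shift S h u v (a d : algC) : (forall x, 0 <= h x) -> 0 <= d ->
  (forall r, `|hat h r| <= a) ->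
  (forall r, r \notin S -> `|hat h r| * 2 <= a * d) ->
  (forall r, r \in S -> `|e (r * (u - v)) - 1| <= d) ->
  rep h u <= rep h v + a * d * \sum_x h x ^+ 2.
Proof.
move=> h0 d0 hat_le offS onS.
have a0 : 0 <= a := le_trans (normr_ge0 _) (hat_le 0).
have M0 : 0 < #|R|%:R :> algC by rewrite ltr0n; apply/card_gt0P; exists 0.
rewrite -lerBlDl -(ler_pM2l M0).
have diff : #|R|%:R * (rep h u - rep h v)
    = \sum_r hat h r * hat h (- r) ^+ 2 * (e (r * u) - e (r * v)).
  rewrite mulrBr !(rep_hat eD sum_e) -sumrB.
  by apply: eq_bigr => r _; rewrite mulrBr.
apply: le_trans (real_ler_norm _) _.
  by rewrite realM ?rpredB ?ger0_real ?ler0n ?rep_ge0.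
rewrite diff; apply: le_trans (ler_norm_sum _ _ _) _.
rewrite mulrCA -(sum_norm_hat2 eD normr_e sum_e h0) mulr_sumr.
apply: ler_sum => r _.
have -> : `|hat h r * hat h (- r) ^+ 2 * (e (r * u) - e (r * v))|
    = `|hat h r| * `|e (r * (u - v)) - 1| * `|hat h r| ^+ 2.
  rewrite expr2 !normrM !(norm_hatN eD normr_e h0) (e_dist eD normr_e).
  by rewrite mulrBr; ring.
rewrite ler_wpM2r ?exprn_ge0 //.
have [rS|rS] := boolP (r \in S); first by rewrite ler_pM ?onS.
apply: le_trans (offS r rS); rewrite ler_wpM2l //.
apply: le_trans (ler_normB _ _) _.
by rewrite normr_e normr1.
Qed.

(** Let [g] be the restriction of [h] to the unpopular points and [V] its mass. [energy_lb] bounds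
    the energy of [g] below by [V^4 / M], unpopularity bounds it above by [V W^3 / (8 M)]; hence
    [(2 V)^3 <= W^3] if [V > 0]. *)
Lemma unpopular_mass h : (forall x, 0 <= h x) ->
  (\sum_(y | 8 * #|R|%:R * rep h y < (\sum_x h x) ^+ 3) h y) * 2 <= \sum_x h x.
Proof.
move=> h0; set W := \sum_x h x; set M := #|R|%:R; pose Y y := 8 * M * rep h y < W ^+ 3.
have W0 : 0 <= W by apply: sumr_ge0.
pose g y := if Y y then h y else 0.
have g0 y : 0 <= g y by rewrite /g; case: ifP.
have gh y : g y <= h y by rewrite /g; case: ifP.
rewrite (_ : \sum_(y | _) h y = \sum_y g y); last by rewrite big_mkcond.
set V := \sum_y g y.
have V0 : 0 <= V by apply: sumr_ge0.
rewrite real_leNgt ?realM ?ger0_real ?ler0n //; apply/negP => ltV.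
have V_gt0 : 0 < V by rewrite -(pmulr_lgt0 _ (ltr0n _ 2)) (le_lt_trans W0).
have: 8 * V ^+ 4 <= V * W ^+ 3.
  apply: le_trans (ler_wpM2l (ler0n _ 8) (energy_lb eD normr_e sum_e g0)) _.
  rewrite mulrA mulr_sumr mulr_suml; apply: ler_sum => y _.
  rewrite mulrCA /g; case: ifP => [Yy|_]; last by rewrite !mul0r.
  rewrite ler_wpM2l //; apply: le_trans (ltW Yy).
  rewrite ler_wpM2l ?mulr_ge0 ?ler0n //.
  apply: ler_sum => x _; apply: ler_sum => z _.
  by apply: ler_pM; rewrite ?g0 ?gh //; [apply: mulr_ge0 | apply: ler_pM];
     rewrite ?g0 ?gh.
have -> : 8 * V ^+ 4 = V * (V * 2) ^+ 3 by ring.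
rewrite ler_pM2l // real_leNgt ?realX ?realM ?ger0_real ?ler0n //.
by rewrite ltrXn2r.
Qed.

(** The last hypothesis keeps the error of [rep_shift] below [W^3 / (16 M)], half of the popularity
    threshold [W^3 / (8 M)]. *)
Lemma sols_dense S h (F : finType) (col : R -> F) (d : algC) :
  (forall x, 0 <= h x) -> 0 <= d ->
  let W := \sum_x h x in
  (forall r, r \notin S -> `|hat h r| * 2 <= W * (d *+ 5)) ->
  (forall x y, col x = col y -> {in S, forall r, `|e (r * (x - y)) - 1| <= d}) ->
  16 * #|R|%:R * (d *+ 5) * \sum_x h x ^+ 2 <= W ^+ 2 ->
  W ^+ 5 <= 64 * #|F|%:R ^+ 2 * #|R|%:R * sols h.
Proof.
move=> h0 d0 W offS onS small; set M : algC := #|R|%:R; set K : algC := #|F|%:R.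
have W0 : 0 <= W by apply: sumr_ge0.
have [->|W_neq0] := eqVneq W 0.
  by rewrite expr0n !mulr_ge0 ?exprn_ge0 ?ler0n ?sols_ge0.
pose Y y := 8 * M * rep h y < W ^+ 3.
(* Only popular points are weighed, so that a heavy cell must contain one. *)
pose g y := if Y y then 0 else h y.
have g0 y : 0 <= g y by rewrite /g; case: ifP.
have R0 : (0 < #|R|)%N by apply/card_gt0P; exists 0.
have [c] := pigeonhole col g0 R0; rewrite -/K; set P := \sum_(i | col i == c) _ => gP.
(* The factor 2 pays for the unpopular points, [K] for the choice of a cell. *)
have WP : W <= 2 * (K * P).
  have split : W = \sum_(y | Y y) h y + \sum_y g y.
    rewrite /W (bigID Y) /=; congr (_ + _).
    rewrite [RHS](bigID Y) /= [X in _ = X + _]big1 ?add0r => [|y]; last by rewrite /g => ->.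
    by apply: eq_bigr => y /negbTE nY; rewrite /g nY.
  have up : (\sum_(y | Y y) h y) * 2 <= W := unpopular_mass h0.
  apply: le_trans (ler_wpM2l (ler0n _ 2) gP).
  rewrite -(lerD2l W) (_ : W + W = (\sum_(y | Y y) h y) * 2 + 2 * \sum_y g y).
    by rewrite lerD2r.
  by rewrite split; ring.
have P0 : 0 <= P by apply: sumr_ge0.
have [y /eqP coly Yy] : exists2 y, col y == c & ~~ Y y.
  have P_neq0 : P != 0.
    by apply: contraNneq W_neq0 => P0'; move: WP; rewrite P0' !mulr0 => le0;
       rewrite eq_le le0.
  have [y coly gy] : exists2 y, col y == c & g y != 0.
    apply/exists_inP; apply: contraNT P_neq0 => /exists_inPn gz.
    by rewrite /P big1 // => i /gz /negPn/eqP.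
  by exists y => //; apply: contraNN gy; rewrite /g => ->.
have popular z w : col z = c -> col w = c ->
    W ^+ 3 <= 16 * M * rep h (w *+ 3 - z *+ 2).
  move=> colz colw.
  (* The shift is [3 (w - y) - 2 (z - y)], both differences lying within one cell; hence the phase
     error [5 d]. *)
  have shift : rep h y <= rep h (w *+ 3 - z *+ 2) + W * (d *+ 5) * \sum_x h x ^+ 2.
    apply: (@rep_shift S) => // [|r|r rS]; first by rewrite mulrn_wge0.
      exact: norm_hat_le.
    rewrite -(dist_eN eD normr_e).
    have -> : - (r * (y - (w *+ 3 - z *+ 2)))
      = (r * (w - y)) *+ 3 + (- (r * (z - y))) *+ 2 by ring.
    apply: le_trans (dist_eD eD normr_e _ _) _.
    have -> : d *+ 5 = 3 * d + 2 * d by ring.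
    by apply: lerD; apply: le_trans (dist_eMn eD normr_e _ _) _;
       rewrite ler_wpM2l ?ler0n ?(dist_eN eD normr_e) // onS ?colz ?colw.
  have M0 : 0 <= M by apply: ler0n.
  have big_y : W ^+ 3 <= 8 * M * rep h y.
    by rewrite real_leNgt ?realX ?realM ?ger0_real ?ler0n ?rep_ge0.
  rewrite -(lerD2r (W ^+ 3)).
  apply: (@le_trans _ _ (16 * M * rep h y)).
    have -> : 16 * M * rep h y = 8 * M * rep h y + 8 * M * rep h y by ring.
    exact: lerD.
  apply: le_trans (ler_wpM2l _ shift) _; first by rewrite mulr_ge0 ?ler0n.
  rewrite mulrDr lerD2l exprS.
  have -> : 16 * M * (W * (d *+ 5) * \sum_x h x ^+ 2)
    = W * (16 * M * (d *+ 5) * \sum_x h x ^+ 2) by ring.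
  by rewrite ler_wpM2l.
pose Q := \sum_(z | col z == c) h z.
have PQ : P <= Q.
  by apply: ler_sum => z _; rewrite /g; case: ifP.
have sols_lb : Q ^+ 2 * W ^+ 3 <= 16 * M * sols h.
  rewrite expr2 /Q big_distrlr /= mulr_suml /sols mulr_sumr big_mkcond /=.
  apply: ler_sum => z _; have term_ge0 w : 0 <= h z * h w * rep h (w *+ 3 - z *+ 2).
    by rewrite !mulr_ge0 ?rep_ge0.
  case: eqP => [colz|_]; last first.
    by apply: mulr_ge0; [rewrite mulr_ge0 ?ler0n | apply: sumr_ge0].
  rewrite mulr_suml mulr_sumr big_mkcond /=; apply: ler_sum => w _.
  case: eqP => [colw|_]; last by rewrite (mulr_ge0 _ (term_ge0 w)) ?mulr_ge0 ?ler0n.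
  rewrite [leRHS]mulrCA ler_wpM2l ?mulr_ge0 //; exact: popular.
have -> : 64 * K ^+ 2 * M * sols h = 4 * K ^+ 2 * (16 * M * sols h) by ring.
apply: le_trans (ler_wpM2l _ sols_lb); last by rewrite mulr_ge0 ?exprn_ge0 ?ler0n.
have -> : W ^+ 5 = W ^+ 2 * W ^+ 3 by ring.
rewrite [leRHS]mulrA ler_wpM2r ?exprn_ge0 //.
have -> : 4 * K ^+ 2 * Q ^+ 2 = (2 * (K * Q)) ^+ 2 by ring.
have Q0 : 0 <= Q by apply: sumr_ge0.
rewrite lerXn2r ?nnegrE // ?mulr_ge0 ?ler0n //.
by apply: le_trans WP _; rewrite !ler_wpM2l ?ler0n.
Qed.

End Counting.

(** * Sets with only trivial solutions *)

Section SolutionFreeSet.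
Context (R : finComNzRingType) (e : R -> algC).
Hypothesis eD : forall x y, e (x + y) = e x * e y.
Hypothesis normr_e : forall x, `|e x| = 1.
Hypothesis sum_e : forall x, \sum_r e (r * x) = #|R|%:R * (x == 0)%:R.
Hypothesis inj2 : injective (fun x : R => x *+ 2).
Hypothesis inj3 : injective (fun x : R => x *+ 3).

Variable A : {set R}.
(** The equation then determines [v], so the conclusion describes exactly the two trivial
    families. *)
Hypothesis sols_trivial : forall x y z v w,
  x \in A -> y \in A -> z \in A -> v \in A -> w \in A ->
  x + y + z *+ 2 = v + w *+ 3 -> z = w /\ (y = w \/ x = w).

Let f x : algC := (x \in A)%:R.
Let M : algC := #|R|%:R.
Let a : algC := #|A|%:R.
Local Notation hat := (hat e).

Lemma f_ge0 x : 0 <= f x. Proof. exact: ler0n. Qed.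

Lemma f_in x : f x != 0 -> x \in A.
Proof. by rewrite pnatr_eq0 eqb0 negbK. Qed.

Lemma sum_f : \sum_x f x = a.
Proof. by rewrite -natr_sum -big_mkcond /= sum1_card. Qed.

(** Solutions in [A] have [z = w], and then [3 w - 2 z = w]. *)
Lemma sols_energy : sols f = \sum_u f u * rep f u.
Proof.
rewrite /sols exchange_big; apply: eq_bigr => w _ /=.
rewrite (bigD1 w) //= big1 ?addr0 => [|z zw].
  have -> : w *+ 3 - w *+ 2 = w by ring.
  by rewrite /f; case: (w \in A); rewrite ?mul0r ?mul1r.
apply/eqP; apply: contraNT zw; rewrite mulf_eq0 negb_or => /andP[].
rewrite mulf_eq0 negb_or => /andP[/f_in zA /f_in wA].
apply: contraNT => zw; rewrite /rep big1 // => x _; rewrite big1 // => y _.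
apply/eqP; apply: contraNT zw.
rewrite !mulf_eq0 !negb_or => /andP[/andP[/f_in xA /f_in yA] /f_in vA].
apply/eqP; have [] // := sols_trivial xA yA zA vA wA; ring.
Qed.

(** The Sidon property: [x + y = u + v] in [A] is a solution with [z = w = u], so [u] is [x] or
    [y]. *)
Lemma energy_le : \sum_u f u * rep f u <= 2 * a ^+ 2.
Proof.
apply: (@le_trans _ _ (\sum_u \sum_x \sum_y f x * f y * ((y == u)%:R + (x == u)%:R))).
  apply: ler_sum => u _; rewrite mulr_sumr; apply: ler_sum => x _.
  rewrite mulr_sumr; apply: ler_sum => y _; rewrite mulrCA.
  have [fxy|] := boolP ((x \in A) && (y \in A)); last first.
    by rewrite negb_and /f => /orP[] /negbTE ->;
       rewrite mulr0n ?mul0r ?mulr0 ?mul0r.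
  have /andP[xA yA] := fxy; apply: ler_wpM2l; first by rewrite mulr_ge0 ?f_ge0.
  rewrite /f -natrM mulnb -natrD ler_nat.
  case: andP => // -[uA vA] /=.
  have eq : x + y + u *+ 2 = (x + y - u) + u *+ 3 by ring.
  have [_ [->|->]] := sols_trivial xA yA uA vA uA eq; rewrite eqxx ?leq_addr //.
  by rewrite leq_addl.
have pick x : \sum_u ((x == u)%:R : algC) = 1.
  rewrite (bigD1 x) //= eqxx big1 ?addr0 // => u.
  by rewrite eq_sym => /negbTE ->.
rewrite exchange_big /= -sum_f expr2 big_distrlr /= mulr_sumr.
apply: ler_sum => x _; rewrite exchange_big /= mulr_sumr; apply: ler_sum => y _.
by rewrite -mulr_sumr big_split /= !pick mulrC.
Qed.

Lemma autocorr_le d : d != 0 -> \sum_x f x * f (x + d) <= 1.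
Proof.
move=> d0; rewrite /f; under eq_bigr do rewrite -natrM mulnb.
rewrite -natr_sum -big_mkcond sum1dep_card lern1.
apply/card_le1_eqP => x y; rewrite !inE => /andP[xA xdA] /andP[yA ydA].
(* Two occurrences of the difference [d] form a solution whose triviality means [y = x] or
   [d = 0]. *)
have eq : x + d + y + x *+ 2 = y + d + x *+ 3 by ring.
have [_ [//|/eqP]] := sols_trivial xdA yA xA ydA xA eq.
by rewrite addrC -subr_eq0 addrK (negbTE d0).
Qed.


Lemma autocorr0 : \sum_x f x * f x = a.
Proof.
rewrite -sum_f; apply: eq_bigr => x _.
by rewrite /f; case: (x \in A); rewrite ?mul0r ?mul1r.
Qed.

(** Pairs are sorted by their difference: 0 occurs [a] times, every other difference at most
    once. *)
Lemma card_sq_le : a ^+ 2 <= a + M.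
Proof.
have -> : a ^+ 2 = \sum_d \sum_x f x * f (x + d).
  rewrite -sum_f expr2 big_distrlr exchange_big /= [RHS]exchange_big /=.
  rewrite exchange_big; apply: eq_bigr => x _.
  by rewrite (reindex_inj (addrI x)).
rewrite (bigD1 0) //=; under eq_bigr do rewrite addr0.
rewrite autocorr0 lerD2l; apply: (@le_trans _ _ (\sum_(d : R) 1)).
  rewrite [leRHS](bigD1 0) //= ler_wpDl ?ler01 //.
  exact: ler_sum autocorr_le.
by rewrite sumr_const.
Qed.

Lemma sum_spread_sq (B : {set R}) :
  \sum_x spread B f x ^+ 2 <= #|B|%:R * a + #|B|%:R ^+ 2.
Proof.
have -> : \sum_x spread B f x ^+ 2
  = \sum_(b in B) \sum_(c in B) \sum_x f (x - b) * f (x - c).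
  under eq_bigr do rewrite expr2 /spread big_distrlr /=.
  by rewrite exchange_big; apply: eq_bigr => b _ /=; rewrite exchange_big.
rewrite expr2 -mulrDr mulr_natl -sumr_const; apply: ler_sum => b bB.
rewrite (bigD1 b) //= lerD //.
  by rewrite (reindex_inj (addIr b)); under eq_bigr do rewrite addrK;
     rewrite autocorr0.
apply: (@le_trans _ _ (\sum_(c in B) 1)); last by rewrite sumr_const.
rewrite [leRHS](bigD1 b) //= ler_wpDl ?ler01 //.
apply: ler_sum => c /andP[_ cb]; rewrite (reindex_inj (addIr b)) /=.
under eq_bigr do rewrite addrK -addrA.
by apply: autocorr_le; rewrite subr_eq0 eq_sym.
Qed.

Definition spectrum (k : nat) := [set r | a <= k%:R * `|hat f r|].

(** Markov's inequality for the fourth moment, which is at most [M * 2 a^2]. *)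
Lemma spectrum_le k (L : nat) : 0 < a -> M <= L%:R * a ^+ 2 ->
  (#|spectrum k| <= 2 * L * k ^ 4)%N.
Proof.
move=> a0 ML; rewrite -(ler_nat algC) -(ler_pM2r (exprn_gt0 4 a0)).
apply: (@le_trans _ _ (k%:R ^+ 4 * \sum_r `|hat f r| ^+ 4)).
  rewrite mulr_natl -sumr_const mulr_sumr big_mkcond /=; apply: ler_sum => r _.
  case: ifP => [|_]; last by rewrite mulr_ge0 ?exprn_ge0 ?ler0n.
  rewrite inE => rS; rewrite -exprMn lerXn2r ?nnegrE ?mulr_ge0 ?ler0n //.
rewrite (sum_norm_hat4 eD normr_e sum_e f_ge0) -/M.
have -> : (2 * L * k ^ 4)%:R * a ^+ 4
  = k%:R ^+ 4 * (L%:R * a ^+ 2 * (2 * a ^+ 2)) by rewrite natrM natrX natrM; ring.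
rewrite ler_wpM2l ?exprn_ge0 ?ler0n // ler_pM ?ler0n ?energy_le //.
by apply: sumr_ge0 => u _; rewrite mulr_ge0 ?f_ge0 ?rep_ge0 //; apply: f_ge0.
Qed.

Lemma off_spectrum k r : (0 < k)%N -> r \notin spectrum k ->
  `|hat f r| <= a / k%:R.
Proof.
move=> k0; rewrite inE -real_ltNge ?realM ?ger0_real ?ler0n //.
by move=> /ltW; rewrite ler_pdivlMr ?ltr0n // mulrC.
Qed.

Definition ncells (L k : nat) := ((k.*2.+1 ^ 2) ^ (2 * L * k ^ 4))%N.

Lemma spectral_partition k (L : nat) :
  (0 < k)%N -> 0 < a -> M <= L%:R * a ^+ 2 ->
  exists (F : finType) (col : R -> F), (#|F| <= ncells L k)%N /\
  forall x y, col x = col y ->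
    {in spectrum k, forall r, `|e (r * (x - y)) - 1| <= 2 / k%:R}.
Proof.
move=> k0 a0 ML; have [F [col [cardF colP]]] := phase_partition eD normr_e (spectrum k) k0.
exists F, col; split=> //.
by rewrite cardF leq_pexp2l ?spectrum_le // expn_gt0.
Qed.

(** Translating a large cell by one of its own points turns agreement of phases within the cell into
    closeness to 1. *)
Lemma bohr_set k (L : nat) :
  (0 < k)%N -> 0 < a -> M <= L%:R * a ^+ 2 ->
  exists B : {set R}, (#|R| <= ncells L k * #|B|)%N /\
    forall b r, b \in B -> r \in spectrum k -> `|e (r * b) - 1| <= 2 / k%:R.
Proof.
move=> k0 a0 ML; have [F [col [cardF colP]]] := spectral_partition k0 a0 ML.
have R0 : (0 < #|R|)%N by apply/card_gt0P; exists 0.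
have [c] := @pigeonhole _ _ (fun=> 1) col (fun=> ler01) R0.
rewrite !sumr_const -natrM ler_nat => cardc.
have [x0 x0c] : exists x0, col x0 = c.
  case: (pickP (fun x => col x == c)) => [x /eqP|none]; first by exists x.
  by move: cardc; rewrite (eq_card0 none) muln0 leqNgt R0.
exists [set x - x0 | x in [pred x | col x == c]]; split.
  rewrite card_imset; last exact: addIr.
  by apply: leq_trans cardc _; rewrite leq_mul2r cardF orbT.
by move=> _ r /imsetP[x /eqP xc ->] rS; apply: colP; rewrite // xc.
Qed.

(** [k1] governs the passage from [A] to its dense model [G], [k2] the count of solutions in [G].
    The loss [K2^2] of the count must be beaten by the error of the passage, so [k1] is chosen after
    [k2]. *)
Lemma card_sol_free (L k2 K2 k1 : nat) : (0 < L)%N ->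
  k2 = (320 * L)%N -> K2 = ncells L k2 -> k1 = (4096 * K2 ^ 2 * L)%N ->
  M <= L%:R * a ^+ 2 ->
  (#|A| <= ncells L k1 + 256 * K2 ^ 2 * L)%N.
Proof.
move=> L0 k2E K2E k1E ML.
have [->//|A0] := posnP #|A|.
have a0 : 0 < a by rewrite ltr0n.
have K2_gt0 : (0 < K2)%N by rewrite K2E /ncells !expn_gt0.
have k2_gt0 : (0 < k2)%N by rewrite k2E muln_gt0.
have k1_gt0 : (0 < k1)%N by rewrite k1E !muln_gt0 K2_gt0.
have [B [cardB BP]] := bohr_set k1_gt0 a0 ML.
have [small|large] := leqP #|A| (ncells L k1); first exact: leq_trans small (leq_addr _ _).
(* Otherwise [M <= N #|B| <= N (a - 1)] with [N = ncells L k1 < a], against [a^2 <= a + M]. *)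
have AB : (#|A| <= #|B|)%N.
  rewrite leqNgt; apply/negP => BA.
  have := card_sq_le; rewrite /a /M -natrX -natrD ler_nat leqNgt => /negP; apply.
  apply: (@leq_ltn_trans (#|A| + ncells L k1 * #|B|)); first by rewrite leq_add2l.
  rewrite -mulnn; apply: (@leq_ltn_trans (#|A| + ncells L k1 * #|A|.-1)).
    by rewrite leq_add2l leq_mul2l -ltnS prednK ?BA ?orbT.
  have n0 : (0 < ncells L k1)%N by rewrite /ncells !expn_gt0.
  move: large; case: #|A| => // p; rewrite ltnS /= => np.
  apply: (@leq_ltn_trans (p.+1 + p * p)); first by rewrite leq_add2l leq_mul2r np orbT.
  by rewrite mulSn ltn_add2l mulnS -[X in (X < _)%N]add0n ltn_add2r (leq_trans n0).
set m : algC := #|B|%:R in BP.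
have am : a <= m by rewrite ler_nat.
have m0 : 0 < m := lt_le_trans a0 am.
pose G := spread B f; have G0 : forall x, 0 <= G x := spread_ge0 B f_ge0.
have sumG : \sum_x G x = m * a by rewrite sum_spread sum_f.
have hat_le r : `|hat f r| <= a by rewrite -sum_f; apply: norm_hat_le f_ge0 r.
have k1R : 0 < k1%:R :> algC by rewrite ltr0n.
have k2R : 0 < k2%:R :> algC by rewrite ltr0n.
have solsG : sols G <= m ^+ 5 * (2 * a ^+ 2 + a * (2 / k1%:R *+ 8) * (2 * a ^+ 2)).
  have := @sols_spread R e eD normr_e sum_e inj2 inj3 (spectrum k1) B f a (2 / k1%:R) f_ge0.
  rewrite sols_energy => /(_ _ hat_le _ BP) H.
  apply: le_trans (H _ _) _ => [|r rS|].
  - by rewrite divr_ge0 ?ler0n.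
  - apply: le_trans (ler_wpM2r (ler0n _ 2) (off_spectrum k1_gt0 rS)) _.
    have -> : a * (2 / k1%:R *+ 8) = a / k1%:R * 16 by ring.
    by rewrite ler_wpM2l ?divr_ge0 ?ler_nat ?ler0n // ltW.
  have dl : 0 <= a * (2 / k1%:R *+ 8) by rewrite mulr_ge0 ?mulrn_wge0 ?divr_ge0 ?ler0n.
  by rewrite ler_wpM2l ?exprn_ge0 ?ler0n // lerD ?energy_le // ler_wpM2l ?energy_le.
have [F [col [cardF colP]]] := spectral_partition k2_gt0 a0 ML.
have denseG : (m * a) ^+ 5 <= 64 * #|F|%:R ^+ 2 * M * sols G.
  rewrite -sumG; apply: (sols_dense eD normr_e sum_e G0 _ _ colP).
  - by rewrite divr_ge0 ?ler0n.
  (* The transform of [G] is that of [f] times [hatset B], so the spectrum of [f] serves for [G]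
     too. *)
  - move=> r rS; rewrite sumG (hat_spread eD) normrM.
    have -> : m * a * (2 / k2%:R *+ 5) = a / k2%:R * m * 10 by ring.
    rewrite ler_pM ?mulr_ge0 ?ler_nat ?ler0n //.
    by rewrite ler_pM ?off_spectrum ?hatset_le.
  rewrite sumG.
  apply: (@le_trans _ _ (16 * (L%:R * a ^+ 2) * (2 / k2%:R *+ 5) * (m ^+ 2 *+ 2))).
    have d0 : 0 <= 2 / k2%:R *+ 5 :> algC by rewrite mulrn_wge0 ?divr_ge0 ?ler0n.
    apply: ler_pM.
    - by rewrite mulr_ge0 ?mulr_ge0 ?ler0n.
    - by apply: sumr_ge0 => x _; rewrite exprn_ge0 ?G0.
    - by rewrite ler_wpM2r // ler_wpM2l ?ler0n.
    apply: le_trans (sum_spread_sq B) _.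
    by rewrite mulr2n lerD2r expr2 ler_wpM2l ?ler0n.
  (* The choice [k2 = 320 L] makes this bound exactly [(m a)^2]. *)
  rewrite k2E natrM.
  have -> : 16 * (L%:R * a ^+ 2) * (2 / (320 * L%:R) *+ 5) * (m ^+ 2 *+ 2) = (m * a) ^+ 2.
    by field; rewrite pnatr_eq0 -lt0n.
  exact: lexx.
have final : (m * a) ^+ 5 <= 64 * K2%:R ^+ 2 * (L%:R * a ^+ 2)
    * (m ^+ 5 * (2 * a ^+ 2 + a * (2 / k1%:R *+ 8) * (2 * a ^+ 2))).
  apply: le_trans denseG _; apply: ler_pM => //; last first.
  - apply: ler_pM; rewrite ?mulr_ge0 ?exprn_ge0 ?ler0n //.
    by rewrite ler_wpM2l ?ler0n // lerXn2r ?nnegrE ?ler0n // ler_nat K2E.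
  - exact: sols_ge0 G0.
  - by rewrite !mulr_ge0 ?exprn_ge0 ?ler0n.
apply: leq_trans (leq_addl _ _); rewrite -(ler_nat algC) -/a.
have ma0 : 0 < m ^+ 5 * a ^+ 4 by rewrite mulr_gt0 ?exprn_gt0.
have natE c : (c * K2 ^ 2 * L)%:R = c%:R * K2%:R ^+ 2 * L%:R :> algC.
  by rewrite natrM natrM natrX.
move: final; rewrite k1E !natE.
set l : algC := L%:R; set K : algC := K2%:R.
have [l0 K0] : l != 0 /\ K != 0 by rewrite !pnatr_eq0 -!lt0n.
(* With [k1 = 4096 K^2 l] the error term is half of the left side [(m a)^5] and can be absorbed; the
   trivial solutions give the rest. *)
have -> : 64 * K ^+ 2 * (l * a ^+ 2) * (m ^+ 5 * (2 * a ^+ 2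
      + a * (2 / (4096 * K ^+ 2 * l) *+ 8) * (2 * a ^+ 2)))
    = m ^+ 5 * a ^+ 4 * (128 * K ^+ 2 * l + a / 2) by field; rewrite l0 K0.
have -> : (m * a) ^+ 5 = m ^+ 5 * a ^+ 4 * a by ring.
rewrite (ler_pM2l ma0) -lerBlDr.
have -> : a - a / 2 = a / 2 by field.
rewrite ler_pdivrMr ?ltr0n // => le_a.
by have -> : 256 * K ^+ 2 * l = 128 * K ^+ 2 * l * 2 by ring.
Qed.

End SolutionFreeSet.

(** * The cyclic group of order [6n + 1] and its characters *)

Section CyclicGroup.
Variables (n : nat) (z : algC).
Local Notation M := (6 * n + 1)%N.
Hypothesis n_gt0 : (0 < n)%N.
Hypothesis z_prim : M.-primitive_root z.

Definition zchar (x : 'Z_M) : algC := z ^+ x.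

Lemma modulus_gt1 : (1 < M)%N.
Proof. by rewrite addn1 ltnS muln_gt0. Qed.

Lemma modulusE : (Zp_trunc M).+2 = M.
Proof. exact: Zp_cast modulus_gt1. Qed.

Lemma zcharD x y : zchar (x + y) = zchar x * zchar y.
Proof. by rewrite /zchar /= {3}modulusE (prim_expr_mod z_prim) exprD. Qed.

Lemma norm_zchar x : `|zchar x| = 1.
Proof.
suff z1 : `|z| = 1 by rewrite normrX z1 expr1n.
have M0 : (0 < M)%N by rewrite addn1.
by apply/eqP; rewrite -(pexpr_eq1 M0) // -normrX (prim_expr_order z_prim) normr1.
Qed.

Lemma sum_zchar x : \sum_r zchar (r * x) = #|'Z_M|%:R * (x == 0)%:R.
Proof.
have [->|x0] := eqVneq.
  under eq_bigr do rewrite mulr0 /zchar expr0.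
  by rewrite sumr_const mulr1.
rewrite mulr0; apply/eqP; set S := \sum_r _.
have : S * (zchar x - 1) == 0.
  (* Replacing [r] by [r + 1] multiplies the sum by [zchar x], which is not 1. *)
  rewrite mulrBr mulr1 subr_eq0 mulr_suml [eqbRHS](reindex_inj (addIr 1)).
  by apply/eqP/eq_bigr => r _; rewrite -zcharD mulrDl mul1r.
rewrite mulf_eq0 subr_eq0 => /orP[//|].
rewrite /zchar -(prim_order_dvd z_prim) => /eqP xM.
have xlt : (x < M)%N by rewrite -[X in (_ < X)%N]modulusE ltn_ord.
by case/eqP: x0; apply/val_inj; move: xM; rewrite modn_small.
Qed.

Lemma natr_modulus : M%:R = 0 :> 'Z_M.
Proof. exact: pchar_Zp modulus_gt1. Qed.

(** [d] is an inverse of [c] modulo [M]. *)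
Lemma mulrn_inj c d k : (c * d = k * M + 1)%N -> injective (fun x : 'Z_M => x *+ c).
Proof.
have kM0 (t : 'Z_M) : t *+ (k * M) = 0.
  by rewrite (mulnC k) mulrnA -(mulr_natr t) natr_modulus mulr0 mul0rn.
move=> cd x y /(congr1 (fun t => t *+ d)); rewrite -!mulrnA cd.
by rewrite !(mulrnDr _ (k * M)) !kM0 !add0r.
Qed.

Lemma natr_eq_modulus a b : (a < M)%N -> (b < M)%N ->
  a%:R = b%:R :> 'Z_M -> a = b.
Proof.
by move=> aM bM /(congr1 val); rewrite /= !val_Zp_nat ?modulus_gt1 // !modn_small.
Qed.

End CyclicGroup.

(** * Return to natural numbers and integers *)

Lemma sol_free_bound (L : nat) : (0 < L)%N -> exists C : nat,
  forall (n : nat) (s : seq nat), (0 < n)%N -> uniq s ->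
  {in s, forall x, (x <= n)%N} ->
  (forall x y t v w, x \in s -> y \in s -> t \in s -> v \in s -> w \in s ->
     x + y + 2 * t = v + 3 * w -> t = w /\ (y = w \/ x = w))%N ->
  (6 * n + 1 <= L * size s ^ 2)%N -> (size s <= C)%N.
Proof.
move=> L0; pose K := ncells L (320 * L); pose k := (4096 * K ^ 2 * L)%N.
exists (ncells L k + 256 * K ^ 2 * L)%N => n s n0 s_uniq s_le s_sol sizes.
have M0 : (0 < 6 * n + 1)%N by rewrite addn1.
have [z z_prim] := C_prim_root_exists M0.
pose A := [set x : 'Z_(6 * n + 1) | x \in [seq a%:R | a <- s]].
have small a : a \in s -> (a < 6 * n + 1)%N by move/s_le; lia.
have cardA : #|A| = size s.
  rewrite cardsE (card_uniqP _) ?size_map // map_inj_in_uniq // => a b sa sb.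
  by apply: natr_eq_modulus; rewrite ?small.
have inA x : x \in A -> exists2 a, a \in s & x = a%:R.
  by rewrite inE => /mapP.
rewrite -cardA.
apply: (@card_sol_free _ (zchar z)
  (zcharD n0 z_prim) (norm_zchar z_prim) (sum_zchar n0 z_prim)
  (mulrn_inj n0 (_ : 2 * (3 * n + 1) = 1 * _ + 1)%N)
  (mulrn_inj n0 (_ : 3 * (4 * n + 1) = 2 * _ + 1)%N) A _ L _ K k) => //; try lia.
  move=> _ _ _ _ _ /inA[x xs ->] /inA[y ys ->] /inA[t ts ->] /inA[v vs ->] /inA[w ws ->].
  have [lx ly lt lv lw] : [/\ x <= n, y <= n, t <= n, v <= n & w <= n]%N.
    by split; apply: s_le.
  rewrite -!mulrnA -!natrD => eq_mod.
  (* Both sides are at most [4n], below the modulus, so the congruence is an equality. *)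
  have eq : (x + y + 2 * t = v + 3 * w)%N.
    by rewrite ![(_ * t)%N]mulnC ![(_ * w)%N]mulnC; apply: natr_eq_modulus eq_mod => //; lia.
  have [-> eqs] := s_sol x y t v w xs ys ts vs ws eq.
  by split=> //; case: eqs => ->; [left | right].
by rewrite cardA -natrX -natrM ler_nat card_ord modulusE.
Qed.

Lemma mem_InP (T : eqType) (x : T) (s : seq T) : reflect (List.In x s) (x \in s).
Proof.
elim: s => [|a s IHs] /=; first by constructor.
rewrite inE eq_sym; apply: (iffP orP) => -[/eqP|/IHs]; auto.
Qed.

Lemma list_sol_free_bound (L : nat) : (0 < L)%coq_nat -> exists C : nat,
  forall (n : nat) (A : list Z), List.NoDup A ->
  (forall a, List.In a A -> Z.le 1 a /\ Z.le a (Z.of_nat n)) ->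
  no_nontrivial_sol A ->
  (6 * n + 1 <= L * (length A * length A))%coq_nat ->
  (length A <= C)%coq_nat.
Proof.
move=> /ssrnat.leP L0; have [C CP] := sol_free_bound L0; exists C => n A uA rA solA large.
have [n_eq0|n0] := posnP n.
  by case: A {uA solA large} rA => [|b A] rA /=; [lia | have := rA b (or_introl erefl); lia].
have inA x : x \in [seq Z.to_nat a | a <- A] -> List.In (Z.of_nat x) A.
  move/mem_InP/(List.in_map_iff Z.to_nat) => [a [<- aA]]; rewrite Z2Nat.id //; have := rA a aA; lia.
have := CP n [seq Z.to_nat a | a <- A] n0; rewrite size_map => bound.
apply/ssrnat.leP; apply: bound => //.
- elim: A uA rA {solA large inA} => //= a A IHA /List.NoDup_cons_iff[naA uA] rA.
  rewrite IHA // ?andbT => [|b bA]; last by apply: rA; right.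
  apply/negP => /mem_InP/(List.in_map_iff Z.to_nat)[b [eq_ab bA]]; apply: naA.
  suff -> : a = b by [].
  have := rA a (or_introl erefl); have := rA b (or_intror bA).
  by move: (@Z2Nat.inj a b) eq_ab; lia.
- move=> x /inA /rA; lia.
- move=> x y t v w /inA xA /inA yA /inA tA /inA vA /inA wA eq.
  have [|p [q]] := solA _ _ _ _ _ xA yA tA vA wA; lia.
by rewrite -mulnn; apply/ssrnat.leP.
Qed.
End SolutionFree.

(** * Deduction of the asymptotic statement *)

Local Open Scope R_scope.

Theorem theorem1p13 :
  forall eps : R, (0 < eps)%R ->
  exists n0 : nat, forall n : nat, (n0 <= n)%nat ->
  forall A : list Z, NoDup A ->
    (forall a, In a A -> (1 <= a <= Z.of_nat n)%Z) ->
    no_nontrivial_sol A ->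
    (INR (length A) <= eps * sqrt (INR n))%R.
Proof.
  intros eps eps_pos.
  (* If [|A| > eps sqrt n], then [L |A|^2 >= 7 n >= 6 n + 1], as [bound] requires. *)
  destruct (INR_unbounded (7 / (eps * eps))) as [L L_large].
  assert (L_pos : (0 < L)%nat).
  { apply INR_lt. simpl. apply Rlt_trans with (2 := L_large).
    apply Rdiv_lt_0_compat; nra. }
  destruct (SolutionFree.list_sol_free_bound L_pos) as [C bound].
  (* For such [n], [eps sqrt n > C], so a counterexample would exceed [C]; the summand 1 ensures
     [n >= 1]. *)
  destruct (INR_unbounded ((INR C / eps) * (INR C / eps) + 1)) as [n0 n0_large].
  exists n0. intros n n_ge A uA rA solA.
  destruct (Rle_or_lt (INR (length A)) (eps * sqrt (INR n))) as [|large]; [assumption|].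
  exfalso.
  apply le_INR in n_ge.
  assert (C_div : INR C / eps * eps = INR C) by (field; lra).
  assert (sqrt_n : sqrt (INR n) * sqrt (INR n) = INR n) by (apply sqrt_sqrt, pos_INR).
  assert (sqrt_pos_n := sqrt_pos (INR n)).
  assert (C_pos : 0 <= INR C / eps).
  { apply Rle_mult_inv_pos; [apply pos_INR | assumption]. }
  assert (sqrt_large : INR C / eps < sqrt (INR n)) by nra.
  assert (C_small : INR C < INR (length A)) by nra.
  apply INR_lt in C_small.
  enough (length A <= C)%nat by lia.
  apply (bound n A uA rA solA).
  apply INR_le. rewrite plus_INR, !mult_INR.
  assert (INR n >= 1) by nra.
  assert (eL : 7 < INR L * (eps * eps)).
  { apply (Rmult_lt_compat_r (eps * eps)) in L_large; [|nra].
    replace (7 / (eps * eps) * (eps * eps)) with 7 in L_large by (field; lra).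
    assumption. }
  assert (sq : (eps * eps) * INR n <= INR (length A) * INR (length A)).
  { replace (eps * eps * INR n) with ((eps * sqrt (INR n)) * (eps * sqrt (INR n)))
      by (rewrite <- sqrt_n at 3; ring).
    apply Rmult_le_compat; nra. }
  apply Rle_trans with (INR L * ((eps * eps) * INR n)).
  - simpl. nra.
  - apply Rmult_le_compat_l; [apply pos_INR | assumption].
Qed.
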